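(* Let $\mathcal{A}$ be a subspace arrangement embedded in the braid arrangement $\mathcal{A}_\ell$, with corresponding edge colored hypergraph $(\mathcal{H},\mathcal{C})$ and set of edge colors $\Lambda$, where $\lambda\not\Subset\lambda'$ for all distinct $\lambda,\lambda'\in\Lambda$. Assume that $(\lambda_1,\lambda_2,\lambda_3)$ is a Massey color system with embedded colors $\lambda_4$ and $\lambda_5$. Choose a linear order $\ll$ on the colors so that $\lambda_1\ll\lambda_2\ll\lambda_3\ll\lambda_4\ll\lambda_5$. Then in the Sinha–Walter spectral sequence for the relative atomic complex $D_{\mathcal{A}}$ (formed using this order), $$d_2\big(a_{\lambda_1}|a_{\lambda_2}|a_{\lambda_3}\big)=\Big[a_{\{\lambda_1,\lambda_2,\lambda_3,\lambda_4\}}+a_{\{\lambda_1,\lambda_2,\lambda_3,\lambda_5\}}\Big].$$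
   Context: **Arrangements and hypergraphs.** Let $V$ be a complex vector space of dimension $\ell$ with coordinates $x_1,\dots,x_\ell$, and let $[\ell]=\{1,\dots,\ell\}$. The braid arrangement $\mathcal{A}_\ell$ is the set of hyperplanes $\{x_i=x_j\}$, $1\le i<j\le\ell$. A subspace arrangement (a finite collection of subspaces of $V$ with no inclusions among them) is embedded in $\mathcal{A}_\ell$ if each of its members is an intersection of hyperplanes of $\mathcal{A}_\ell$. A hypergraph $\mathcal{H}=([\ell],E)$ is given by a finite collection $E$ of subsets (edges) of $[\ell]$, each with at least two elements; an edge coloring is a function $\mathcal{C}:E\to\Lambda$ to a finite set $\Lambda$ of colors. For an edge $e=\{i_1,\dots,i_s\}$ put $\nu(e)=\{v\in V: v_{i_1}=\cdots=v_{i_s}\}$, and for $\lambda\in\Lambda$ put $X_\lambda=\bigcap_{e\in\mathcal{C}^{-1}(\lambda)}\nu(e)$. The arrangement corresponding to $(\mathcal{H},\mathcal{C})$ is $\{X_\lambda\}_{\lambda\in\Lambda}$. Conversely, to an arrangement $\{X_1,\dots,X_n\}$ embedded in $\mathcal{A}_\ell$ corresponds the edge colored hypergraph with color set $[n]$ whose edges of color $i$ are the blocks with more than one element of the partition of $[\ell]$ given by $r\sim_i s$ if and only if $r=s$ or $X_i\subseteq\{x_r=x_s\}$. Codimensions are taken in $V$. **Refinement.** A set of edges is connected if any two vertices in its union are joined by a chain of consecutively intersecting edges from the set; the connected components of a set of edges are its maximal connected subsets. For $\Gamma,\Gamma'\subseteq\Lambda$, write $\Gamma\Subset\Gamma'$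 (equivalently $\Gamma'\Supset\Gamma$) if the vertex set of each connected component of $\mathcal{C}^{-1}(\Gamma)$ is contained in the vertex set of some connected component of $\mathcal{C}^{-1}(\Gamma')$; equivalently, $\bigcap_{\gamma\in\Gamma}X_\gamma\supseteq\bigcap_{\gamma\in\Gamma'}X_\gamma$. A single color $\lambda$ is identified with $\{\lambda\}$. **Multiplicative.** $\Gamma,\Gamma'\subseteq\Lambda$ are multiplicative if $\operatorname{codim}\bigcap_{\gamma\in\Gamma}X_\gamma+\operatorname{codim}\bigcap_{\gamma\in\Gamma'}X_\gamma=\operatorname{codim}\bigcap_{\gamma\in\Gamma\cup\Gamma'}X_\gamma$. **Massey color system.** For $\lambda_1,\lambda_2,\lambda_3\in\Lambda$, the triple $(\lambda_1,\lambda_2,\lambda_3)$ is a Massey color system if the pair $\lambda_1,\lambda_2$ and the pair $\{\lambda_1,\lambda_2\},\lambda_3$ are multiplicative and there exist $\lambda_4,\lambda_5\in\Lambda$ (called embedded colors) such that $\{\lambda_1,\lambda_2\}\Supset\lambda_4$, $\{\lambda_2,\lambda_4\}\not\Supset\lambda_1$, $\{\lambda_1,\lambda_4\}\not\Supset\lambda_2$, and $\{\lambda_2,\lambda_3\}\Supset\lambda_5$, $\{\lambda_3,\lambda_5\}\not\Supset\lambda_2$, $\{\lambda_2,\lambda_5\}\not\Supset\lambda_3$. **Relative atomic complex.** Fix a linear order on $\Lambda$. For $\sigma\subseteq\Lambda$ write $\bigvee\sigma=\bigcap_{\lambda\in\sigma}X_\lambda$. $D_{\mathcal{A}}$ is the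 differential graded algebra over $\mathbb{Q}$ with a generator (as a vector space) $a_\sigma$ in degree $2\operatorname{codim}\bigvee\sigma-|\sigma|$ for each $\sigma\subseteq\Lambda$ (we write $a_\lambda$ for $a_{\{\lambda\}}$). For $\sigma=\{i_1<\cdots<i_k\}$ the differential is $d a_\sigma=\sum_{j:\ \bigvee(\sigma\setminus i_j)=\bigvee\sigma}(-1)^j a_{\sigma\setminus i_j}$. The product is $a_\sigma a_\tau=(-1)^{\varepsilon(\sigma,\tau)}a_{\sigma\cup\tau}$ if $\operatorname{codim}\bigvee\sigma+\operatorname{codim}\bigvee\tau=\operatorname{codim}\bigvee(\sigma\cup\tau)$ and $0$ otherwise, where $(-1)^{\varepsilon(\sigma,\tau)}$ is the sign of the permutation that reorders the linearly ordered set $\sigma\cup\tau$ so that the elements of $\tau$ come after those of $\sigma$. **Sinha–Walter spectral sequence.** Let $W$ be a commutative differential graded algebra over $\mathbb{Q}$. Let $\mathrm{Graphs}(n)$ be the vector space spanned by acyclic directed graphs with $n$ labeled vertices, and let $\sim$ be the equivalence relation generated by: (arrow reversing) reversing one edge multiplies the graph by $-1$; (Arnold) for vertices $a,b,c$, the sum of the three graphs that contain respectively the edge pairs $\{a\to b,\ b\to c\}$, $\{b\to c,\ c\to a\}$, $\{c\to a,\ a\to b\}$ and otherwise agree is $0$. Put $\mathbb{E}(W)=\bigoplus_n(\mathrm{Graphs}(n)/\sim)\otimes_{\Sigma_n}W^{\otimes n}$, with the symmetric group $\Sigma_n$ acting diagonally. There are two differentials on $\mathbb{E}(W)$. First, $d_W$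 is the canonical extension of the differential of $W$. Second, $d_\mu=\sum_e\mu_e$, the sum being over edges $e$ of the graph, where, after choosing a representative in which $e$ goes from vertex $1$ to vertex $2$ and the first two tensor entries are $a,b$, $\mu_e$ contracts $e$ to a vertex numbered $1$ (shifting the later labels down by one) and replaces $a\otimes b$ by $(-1)^{|a|}(ab)$, with $|a|$ the degree of $a$. The Sinha–Walter spectral sequence of $W$ is the spectral sequence of the bicomplex $\mathbb{E}(W)$, with total differential built from $d_W$ and $d_\mu$, filtered by columns (the column being the number of edges of the graph), so that $d_0$ is induced by $d_W$. The notation $a_1|a_2|\cdots|a_n$ stands for the class of the graph $1\to2\to\cdots\to n$ tensored with $a_1\otimes\cdots\otimes a_n$, and $[w]$ denotes the class of $w\in W$ in the column of one-vertex graphs.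
   Formalization: The right-hand side is proved with −a_{λ1λ2λ3λ4} in place of +a_{λ1λ2λ3λ4}; as displayed, the sum is not a cocycle, since with this order its differential is 2a_{λ1λ2λ3} ≠ 0, so its class is undefined. *)

(* Defs.v *)
From HB Require Import structures.
From mathcomp Require Import all_boot all_order all_fingroup all_algebra.
From mathcomp Require Import reals complex.
From mathcomp Require Import freeg.

Set Implicit Arguments.
Unset Strict Implicit.
Unset Printing Implicit Defensive.

Import Order.TTheory GRing.Theory Num.Theory.
Local Open Scope ring_scope.

(** * Subspace arrangements and edge colored hypergraphs *)

Section Arrangements.
Variables (C : fieldType) (l : nat).
Local Notation V := 'rV[C]_l.

Definition coord_diff (i j : 'I_l) (v : V) : C^o := v ord0 i - v ord0 j.

Fact coord_diff_is_linear i j : linear (coord_diff i j).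
Proof.
move=> a u v; rewrite /coord_diff !mxE scalerBr /= /GRing.scale /=.
by rewrite opprD addrACA.
Qed.

HB.instance Definition _ i j :=
  GRing.isLinear.Build C V C^o _ (coord_diff i j) (coord_diff_is_linear i j).

Definition hyperplane (i j : 'I_l) : {vspace V} := lker (linfun (coord_diff i j)).

Definition codim (U : {vspace V}) : nat := (\dim {:V} - \dim U)%N.

Definition subspace_arrangement (L : finType) (X : L -> {vspace V}) : Prop :=
  forall c c', c != c' -> ~~ (X c <= X c')%VS.

Definition embedded_in_braid (L : finType) (X : L -> {vspace V}) : Prop :=
  forall c, exists S : {set 'I_l * 'I_l},
    (forall p, p \in S -> (p.1 < p.2)%N) /\
    X c = (\bigcap_(p in S) hyperplane p.1 p.2)%VS.

(** The flat [\bigvee G], the intersection of the members indexed by [G]. *)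
Definition flat (L : finType) (X : L -> {vspace V}) (G : {set L}) : {vspace V} :=
  (\bigcap_(c in G) X c)%VS.

Definition multiplicative (L : finType) (X : L -> {vspace V}) (G G' : {set L}) :=
  (codim (flat X G) + codim (flat X G'))%N = codim (flat X (G :|: G')).

End Arrangements.

(** The edges form an indexed family, so that the same subset may occur as an
    edge of several colors: two members of an arrangement can have a block in
    common. *)
Record colored_hypergraph (l : nat) (L : finType) := ColoredHypergraph {
  edge_index : finType;
  edge : edge_index -> {set 'I_l};
  edge_ge2 : forall e, (1 < #|edge e|)%N;
  color : edge_index -> L
}.

Section Hypergraphs.
Variables (l : nat) (L : finType) (H : colored_hypergraph l L).

Definition nu (C : fieldType) (A : {set 'I_l}) : {vspace 'rV[C]_l} :=
  (\bigcap_(i in A) \bigcap_(j in A) hyperplane C i j)%VS.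

Definition arrangement_of (C : fieldType) (c : L) : {vspace 'rV[C]_l} :=
  (\bigcap_(e : edge_index H | color e == c) nu C (edge e))%VS.

Implicit Types (S T : {set edge_index H}) (G : {set L}).

Definition edges_of_colors G : {set edge_index H} := [set e | color e \in G].

Definition vertices S : {set 'I_l} := \bigcup_(e in S) edge e.

Definition meeting S : rel (edge_index H) :=
  [rel e f | [&& e \in S, f \in S & edge e :&: edge f != set0]].

Definition connected_edges S : bool :=
  [forall i in vertices S, forall j in vertices S,
    exists e in S, exists f in S,
      [&& i \in edge e, j \in edge f & connect (meeting S) e f]].

Definition is_component S T : bool :=
  maxset (fun T' => (T' \subset S) && connected_edges T') T.

(** [refines G G'] is the relation G \Subset G'. *)
Definition refines (G G' : {set L}) : bool :=
  [forall (T | is_component (edges_of_colors G) T),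
    exists (T' | is_component (edges_of_colors G') T'),
      vertices T \subset vertices T'].

(** [(c1, c2, c3)] is a Massey color system with embedded colors [c4] and [c5]. *)
Definition massey_color_system (C : fieldType) (c1 c2 c3 c4 c5 : L) : Prop :=
  let X := arrangement_of C in
  [/\ multiplicative X [set c1] [set c2],
      multiplicative X [set c1; c2] [set c3],
      [/\ refines [set c4] [set c1; c2],
          ~~ refines [set c1] [set c2; c4] &
          ~~ refines [set c2] [set c1; c4]] &
      [/\ refines [set c5] [set c2; c3],
          ~~ refines [set c2] [set c3; c5] &
          ~~ refines [set c3] [set c2; c5]]].

End Hypergraphs.

(** * Differential graded algebras presented on a homogeneous basis *)

Record dga_on_basis := DgaOnBasis {
  gen : choiceType;
  gdeg : gen -> int;
  gdiff : gen -> {freeg gen / rat};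
  gmul : gen -> gen -> {freeg gen / rat}
}.

(** * The relative atomic complex *)

Section RelativeAtomicComplex.
Variables (C : fieldType) (l : nat) (disp : Order.disp_t).
Variables (L : finOrderType disp) (X : L -> {vspace 'rV[C]_l}).
Implicit Types (s t : {set L}).

Definition atomic_deg s : int := (2 * codim (flat X s))%:Z - #|s|%:Z.

(** The position, counted from 1, of [i] in the increasing enumeration of [s]. *)
Definition position s (i : L) : nat := #|[set k in s | (k <= i)%O]|.

Definition atomic_diff s : {freeg {set L} / rat} :=
  \sum_(i in s | flat X (s :\ i) == flat X s)
    (-1) ^+ position s i *: << s :\ i >>.

(** The number of inversions of the permutation that moves the elements of [t]
    behind those of [s]. *)
Definition shuffle_inversions s t : nat :=
  #|[set p : L * L | [&& p.1 \in s, p.2 \in t & (p.2 < p.1)%O]]|.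

Definition atomic_mul s t : {freeg {set L} / rat} :=
  if (codim (flat X s) + codim (flat X t) == codim (flat X (s :|: t)))%N
  then (-1) ^+ shuffle_inversions s t *: << s :|: t >> else 0.

Definition relative_atomic_complex : dga_on_basis :=
  @DgaOnBasis {set L} atomic_deg atomic_diff atomic_mul.

End RelativeAtomicComplex.

(** * Acyclic directed graphs *)

Definition digraph (n : nat) := {set 'I_n * 'I_n}.

Section Digraphs.
Variable n : nat.
Implicit Types (g : digraph n) (e : 'I_n * 'I_n).

Definition adj g : rel 'I_n := [rel u v | ((u, v) \in g) || ((v, u) \in g)].

(** No cycle in the underlying undirected multigraph: no loop, no pair of
    opposite arrows, and no simple closed path on at least three vertices. *)
Definition acyclic g : bool :=
  [&& [forall u, (u, u) \notin g],
      [forall u, forall v, ~~ (((u, v) \in g) && ((v, u) \in g))] &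
      [forall k : 'I_n.+1, forall c : k.-tuple 'I_n,
        (2 < k)%N ==> ~~ ucycleb (adj g) c]].

Definition reverse_edge g e : digraph n := (e.2, e.1) |: (g :\ e).

Definition relabel (s : 'S_n) g : digraph n := [set (s e.1, s e.2) | e in g].

Definition path_graph : digraph n := [set e : 'I_n * 'I_n | val e.2 == (val e.1).+1].

End Digraphs.

(** A permutation sending [i] to the first and [j] to the second vertex. *)
Definition to_front m (i j : 'I_m.+2) : 'S_m.+2 :=
  (tperm i ord0 * tperm (tperm i ord0 j) (inord 1))%g.

(** Contraction of the edge from vertex 0 to vertex 1. *)
Definition squash m (i : 'I_m.+2) : 'I_m.+1 := inord i.-1.

Definition contract_graph m (g : digraph m.+2) : digraph m.+1 :=
  [set (squash e.1, squash e.2) | e in g :\ (ord0, inord 1)].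

Lemma connect_sim (T T' : finType) (r : rel T) (r' : rel T') (Q : T -> T' -> Prop) :
  (forall a b a', r a b -> Q a a' -> exists2 b', Q b b' & connect r' a' b') ->
  forall a b a', connect r a b -> Q a a' -> exists2 b', Q b b' & connect r' a' b'.
Proof.
move=> sim a b a' /connectP[p]; elim: p a a' => [|c p IHp] a a' /=.
  by move=> _ -> Qa; exists a'.
case/andP=> rac pathp def_b Qa; have [c' Qc a'c'] := sim _ _ _ rac Qa.
have [b' Qb c'b'] := IHp _ _ pathp def_b Qc.
by exists b' => //; apply: connect_trans c'b'.
Qed.

Section AcyclicTheory.
Variable n : nat.
Implicit Types (g : digraph n) (e : 'I_n * 'I_n).

Lemma adjE g u v : adj g u v = ((u, v) \in g) || ((v, u) \in g).
Proof. by []. Qed.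

Lemma connect_adj_sym g : connect_sym (adj g).
Proof. by apply: sym_connect_sym => u v; rewrite !adjE orbC. Qed.

Lemma acyclic_cycleP g :
  reflect [/\ forall u, (u, u) \notin g,
              forall u v, (u, v) \in g -> (v, u) \notin g &
              forall c, uniq c -> path.cycle (adj g) c -> (size c <= 2)%N]
          (acyclic g).
Proof.
apply: (iffP and3P) => [[/forallP nl /forallP no nc]|[nl no nc]].
  split=> // [u v uvg|c uniqc cyc].
    by have /forallP/(_ v) := no u; rewrite uvg.
  have size_c: (size c < n.+1)%N.
    by rewrite ltnS -[n in (_ <= n)%N]card_ord -(card_uniqP uniqc) max_card.
  have /forallP/(_ (@Tuple (Ordinal size_c) _ c (eqxx _))) := forallP nc (Ordinal size_c).
  by rewrite /ucycleb /= uniqc cyc implybF -leqNgt.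
split; first exact/forallP.
  by apply/forallP=> u; apply/forallP=> v; apply/negP=> /andP[/no/negPf->].
apply/forallP=> k; apply/forallP=> c; apply/implyP=> k_gt2.
by apply/negP=> /andP[cyc uniqc]; have := nc c uniqc cyc; rewrite size_tuple leqNgt k_gt2.
Qed.

Lemma acyclic_bridgeP g :
  reflect (forall e, e \in g -> ~~ connect (adj (g :\ e)) e.1 e.2) (acyclic g).
Proof.
apply: (iffP (acyclic_cycleP g)) => [[nl no nc] [u v] uvg|bridge].
  apply/negP => /connectP[p]; case/shortenP => {}p pathp uniqp _ /= lastp.
  have sub: subrel (adj (g :\ (u, v))) (adj g).
    by move=> a b; rewrite !adjE !inE => /orP[]/andP[_ ->]; rewrite ?orbT.
  case: p => [|x [|y p]] in pathp uniqp lastp *.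
  - by move: uvg; rewrite lastp; apply/negP/nl.
  - move: pathp lastp => /= + eqv; rewrite adjE -eqv !inE eqxx /= andbT.
    by case/andP=> _; apply/negP/no.
  suff cyc: path.cycle (adj g) [:: u, x, y & p] by have := nc _ uniqp cyc.
  rewrite -[path.cycle _ _]/(path (adj g) u (rcons [:: x, y & p] u)) rcons_path.
  by rewrite (sub_path sub pathp) -lastp adjE uvg orbT.
have noloop u : (u, u) \notin g.
  by apply/negP=> /bridge; rewrite connect0.
split=> // [u v uvg|[|x [|y [|z q]]] // uniqc cyc].
  have neq: u != v by apply: contraTneq uvg => ->; apply: noloop.
  apply/negP => vug; have /negP[] := bridge _ uvg; apply: connect1.
  by rewrite adjE !inE vug !xpair_eqE [v == u]eq_sym (negPf neq) orbT.
suff{bridge} [e eg]: exists2 e, e \in g & connect (adj (g :\ e)) e.1 e.2.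
  by rewrite (negPf (bridge e eg)).
move: cyc; rewrite -[path.cycle _ _]/(path _ _ (rcons [:: y, z & q] x)).
case/andP=> xy /andP[yz pathz].
have [e eg def_e]: exists2 e, e \in g & e = (x, y) \/ e = (y, x).
  by move: xy; rewrite adjE => /orP[] eg; [exists (x, y) | exists (y, x)] => //; [left | right].
exists e => //.
have step a b : a \notin [:: x; y] -> adj g a b -> adj (g :\ e) a b.
  rewrite !adjE !inE negb_or => /andP[ax ay].
  have [-> ->]: ((a, b) == e) = false /\ ((b, a) == e) = false.
    by case: def_e => ->; rewrite !xpair_eqE (negPf ax) (negPf ay) ?andbF.
  by [].
move: uniqc; rewrite /= !inE !negb_or.
case/and4P=> /and3P[xy' xz xq] /andP[yz' yq] zq uniqq.
have yz2: adj (g :\ e) y z.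
  have: adj (g :\ e) z y.
    apply: step; last by rewrite adjE orbC.
    by rewrite !inE negb_or eq_sym xz eq_sym.
  by rewrite adjE orbC.
have pathz2: path (adj (g :\ e)) z (rcons q x).
  have: z \notin [:: x; y] by rewrite !inE negb_or eq_sym xz eq_sym.
  elim: q z xq yq pathz {yz zq uniqq xz yz' yz2} => [|t q IHq] z /=.
    by move=> _ _ /andP[zx _] nz; rewrite step.
  rewrite !inE !negb_or => /andP[xt xq] /andP[yt yq] /andP[zt pt] nz.
  apply/andP; split; first by apply: step; rewrite // !inE negb_or.
  by apply: IHq => //; rewrite !inE negb_or eq_sym xt eq_sym.
have yx: connect (adj (g :\ e)) y x.
  apply/connectP; exists (rcons (z :: q) x); last by rewrite last_rcons.
  by rewrite rcons_cons /= yz2.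
by case: def_e yx => -> //=; rewrite connect_adj_sym.
Qed.

Lemma acyclic_reverse_edge g e : acyclic g -> e \in g -> acyclic (reverse_edge g e).
Proof.
move=> acg eg; have /acyclic_bridgeP bridge := acg.
have [nl no _] := acyclic_cycleP g acg.
case: e eg => u v uvg; apply/acyclic_bridgeP=> -[x y].
have sub f : (f \in g) || (f == (v, u)) -> f != (x, y) -> (x, y) \in g ->
    (x, y) != (u, v) -> adj (g :\ (x, y)) f.1 f.2.
  case: f => a b /orP[abg|/eqP[-> ->]] ne xyg ne'; rewrite adjE /= !inE ?ne ?abg //.
  by rewrite uvg eq_sym ne' orbT.
rewrite !inE => /orP[/eqP[-> ->]|/andP[ne xyg]] /=.
  apply: contra (bridge _ uvg); rewrite connect_adj_sym.
  apply: connect_sub => a b; rewrite adjE !inE => h; apply: connect1.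
  by rewrite adjE !inE; case/orP: h => /andP[/negPf-> /= /andP[-> ->]]; rewrite ?orbT.
apply: contra (bridge _ xyg); apply: connect_sub => a b.
rewrite adjE !inE => h; case/orP: h => /andP[ne2 h]; last rewrite connect_adj_sym;
  by apply: connect1; apply: (sub (_, _)) => //; case/orP: h => [->|/andP[_ ->]]; rewrite ?orbT.
Qed.

Lemma acyclic_relabel (s : 'S_n) g : acyclic g -> acyclic (relabel s g).
Proof.
move/acyclic_bridgeP=> bridge; apply/acyclic_bridgeP=> _ /imsetP[e eg ->] /=.
apply: contra (bridge e eg) => con.
have [|b /perm_inj -> //] := @connect_sim _ _ _ (adj (g :\ e)) (fun a a' => a = s a')
  _ _ _ e.1 con erefl.
move=> _ b a /[swap] ->; rewrite adjE !inE => /orP[]/andP[ne /imsetP[f fg def_f]].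
- exists f.2; first by case: def_f.
  have -> : a = f.1 by case: def_f => /perm_inj.
  apply: connect1; rewrite adjE !inE -surjective_pairing fg andbT.
  by apply/orP; left; apply: contraNneq ne => <-; apply/eqP.
- exists f.1; first by case: def_f.
  have -> : a = f.2 by case: def_f => _ /perm_inj.
  apply: connect1; rewrite adjE !inE -surjective_pairing fg andbT.
  by apply/orP; right; apply: contraNneq ne => <-; apply/eqP.
Qed.

Lemma acyclic_path_graph : acyclic (path_graph n).
Proof.
apply/acyclic_bridgeP=> -[u v]; rewrite inE /= => /eqP def_v; apply/negP=> con.
have [|b [_ vu] _] := @connect_sim _ _ _ (adj (path_graph n)) (fun a a' => a = a' /\ (a <= u)%N)
  _ _ _ u con (conj erefl (leqnn u)); last by rewrite def_v ltnn in vu.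
move=> a b _ /[swap] -[<- au]; rewrite adjE !inE /= !xpair_eqE => ab.
exists b; last by apply: connect1; rewrite adjE !inE /=; case/orP: ab => /andP[_ ->]; rewrite ?orbT.
split=> //; case/orP: ab => /andP[ne /eqP ab]; last first.
  by rewrite -ltnS (leq_trans _ (leqW au)) // ab.
rewrite ab ltn_neqAle au andbT; apply: contra ne => /eqP/val_inj au'.
by rewrite au' eqxx /=; apply/eqP/val_inj; rewrite /= ab def_v au'.
Qed.

End AcyclicTheory.

Lemma acyclic_contract_graph m (g : digraph m.+2) :
  acyclic g -> (ord0, inord 1) \in g -> acyclic (contract_graph g).
Proof.
move=> acg eg; have /acyclic_bridgeP bridge := acg.
apply/acyclic_bridgeP=> _ /imsetP[f /setD1P[ne fg] ->] /=.
apply: contra (bridge f fg) => con.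
have fibre a b : squash a = squash b -> connect (adj (g :\ f)) a b.
  rewrite /squash => /(congr1 val); rewrite /= !inordK; last 2 first.
  - by case: b => -[|b].
  - by case: a => -[|a].
  have e01: adj (g :\ f) ord0 (inord 1) by rewrite adjE !inE eg eq_sym ne.
  have [->|a0] := eqVneq a ord0; have [->|b0] := eqVneq b ord0 => // ab.
  - by apply: connect1; have <- : inord 1 = b by apply: val_inj; rewrite /= inordK //;
      move: b0 ab; case: (b) => -[|[|k]].
  - by rewrite connect_adj_sym; apply: connect1;
      have <- : inord 1 = a by apply: val_inj; rewrite /= inordK //;
      move: a0 ab; case: (a) => -[|[|k]].
  have -> : a = b; last exact: connect0.
  by apply: val_inj; move: a0 b0 ab; case: (a) (b) => -[|x] ? [[|y] ?] //= _ _ ->.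
have [|b /fibre h1 h2] := @connect_sim _ _ _ (adj (g :\ f))
  (fun a a' => squash a' = a) _ _ _ f.1 con erefl; last exact: connect_trans h2 h1.
move=> _ b a /[swap] <-; rewrite adjE !inE.
case/orP=> /andP[ne2 /imsetP[k /setD1P[_ kg] [ak bk]]].
- exists k.2 => //; apply: connect_trans (fibre _ _ ak) _.
  apply: connect1; rewrite adjE !inE -surjective_pairing kg andbT.
  by apply/orP; left; apply: contraNneq ne2 => <-; rewrite ak bk.
- exists k.1 => //; apply: connect_trans (fibre _ _ bk) _.
  apply: connect1; rewrite adjE !inE -surjective_pairing kg andbT.
  by apply/orP; right; apply: contraNneq ne2 => <-; rewrite ak bk.
Qed.

(** * The bicomplex *)

Section Bicomplex.
Variable W : dga_on_basis.

Definition labelling (n : nat) := {ffun 'I_n -> gen W}.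

Definition decorated_graph : choiceType :=
  {n : nat & ({g : digraph n | acyclic g} * labelling n)%type}.

(** The sum over n of Graphs(n) \otimes W^{\otimes n}; the quotient E(W) is taken
    below, by the span of [relator]. *)
Definition decorated_module := {freeg decorated_graph / rat}.
Local Notation M := decorated_module.

(** The generator [g (x) b] for acyclic [g]. The default value is never used:
    see [acyclic_reverse_edge], [acyclic_relabel], [acyclic_contract_graph] and
    [acyclic_path_graph]. *)
Definition decorate n (g : digraph n) (b : labelling n) : M :=
  if insub g is Some h
  then << (Tagged (fun n => ({g : digraph n | acyclic g} * labelling n)%type)
            (h, b) : decorated_graph) >>
  else 0.

Definition edge_count (x : decorated_graph) : nat := #|val (tagged x).1|.

(** Tensor entries are permuted with the Koszul sign of the desuspension
    s^{-1}W, in which [a] has degree |a| - 1: this is the sign for which d_mu is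
    compatible with the relations. *)
Definition koszul n (s : 'S_n) (b : labelling n) : rat :=
  \prod_(p : 'I_n * 'I_n | (p.1 < p.2)%N && (s p.2 < s p.1)%N)
    (-1) ^ ((gdeg (b p.1) - 1) * (gdeg (b p.2) - 1)).

Definition permute n (s : 'S_n) (b : labelling n) : labelling n :=
  [ffun i => b ((s^-1)%g i)].

Inductive relator : M -> Prop :=
| ArrowReversing n (g : digraph n) e b of acyclic g & e \in g :
    relator (decorate g b + decorate (reverse_edge g e) b)
| Arnold n (g : digraph n) (u v w : 'I_n) b
    of acyclic (g :|: [set (u, v); (v, w)])
     & acyclic (g :|: [set (v, w); (w, u)])
     & acyclic (g :|: [set (w, u); (u, v)]) :
    relator (decorate (g :|: [set (u, v); (v, w)]) b +
             decorate (g :|: [set (v, w); (w, u)]) b +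
             decorate (g :|: [set (w, u); (u, v)]) b)
| Coinvariance n (g : digraph n) (s : 'S_n) b of acyclic g :
    relator (koszul s b *: decorate (relabel s g) (permute s b) - decorate g b).

Inductive relations : M -> Prop :=
| relations0 : relations 0
| relationsD k r x of relator r & relations x : relations (k *: r + x).

Definition set_label n (b : labelling n) (k : 'I_n) (c : gen W) : labelling n :=
  [ffun i => if i == k then c else b i].

Definition dW_gen n (g : digraph n) (b : labelling n) : M :=
  \sum_(k < n) (-1) ^ (\sum_(i < n | (i < k)%N) (gdeg (b i) - 1)) *:
    fglift (fun c => decorate g (set_label b k c)) (gdiff (b k)).

Definition merge_labels m (b : labelling m.+2) (c : gen W) : labelling m.+1 :=
  [ffun k : 'I_m.+1 => if k == ord0 then c else b (fintype.lift ord0 k)].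

(** mu_e for the edge e from vertex 0 to vertex 1. *)
Definition contract_front m (g : digraph m.+2) (b : labelling m.+2) : M :=
  (-1) ^ gdeg (b ord0) *:
    fglift (fun c => decorate (contract_graph g) (merge_labels b c))
      (gmul (b ord0) (b (inord 1))).

Definition mu m (e : 'I_m.+2 * 'I_m.+2) (g : digraph m.+2) (b : labelling m.+2) : M :=
  let s := to_front e.1 e.2 in
  koszul s b *: contract_front (relabel s g) (permute s b).

Definition dmu_gen n : digraph n -> labelling n -> M :=
  match n with
  | m.+2 => fun g b => \sum_(e in g) mu e g b
  | _ => fun _ _ => 0
  end.

Definition dW (x : M) : M :=
  fglift (fun y : decorated_graph => dW_gen (val (tagged y).1) (tagged y).2) x.

Definition dmu (x : M) : M :=
  fglift (fun y : decorated_graph => dmu_gen (val (tagged y).1) (tagged y).2) x.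

Definition dtotal (x : M) : M := dW x + dmu x.

Definition columns_le (p : int) (x : M) : Prop :=
  {in dom x, forall y, (edge_count y)%:Z <= p}.

(** The element a_1|a_2|...|a_n. *)
Definition bar n (b : n.-tuple (gen W)) : M :=
  decorate (path_graph n) [ffun i => tnth b i].

Definition one_vertex (w : {freeg (gen W) / rat}) : M :=
  fglift (fun c : gen W => bar [tuple c]) w.

End Bicomplex.

(** * The spectral sequence of a filtered complex

    The complex is the quotient [M / N] with the differential induced by [D],
    filtered by the images of the increasing family [F]. *)

Section SpectralSequence.
Variables (M : lmodType rat) (N : M -> Prop) (D : M -> M) (F : int -> M -> Prop).

Definition filtration (p : int) (x : M) : Prop := exists2 y, F p y & N (x - y).

(** The page E_r^p is the quotient of [cycles r p] by [boundaries r p]. *)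
Definition cycles (r : int) (p : int) (x : M) : Prop :=
  filtration p x /\ filtration (p - r) (D x).

Definition boundaries (r : int) (p : int) (x : M) : Prop :=
  exists u v, [/\ cycles (r - 1) (p - 1) u, cycles (r - 1) (p + r - 1) v &
                  N (x - (u + D v))].

(** The element of E_0^p represented by [x] survives to E_r^p, where its class is
    that of [z]. *)
Definition survives_as (r p : int) (x z : M) : Prop :=
  cycles r p z /\ filtration (p - 1) (z - x).

(** [x] and [y] represent elements of E_0^p and E_0^{p-r} that survive to the
    r-th page, and d_r maps the class of [x] to the class of [y]. *)
Definition page_differential (r p : int) (x y : M) : Prop :=
  exists z z', [/\ survives_as r p x z, survives_as r (p - r) y z' &
                   boundaries r (p - r) (D z - z')].

End SpectralSequence.

Definition sinha_walter_d (W : dga_on_basis) (r p : int)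
    (x y : decorated_module W) : Prop :=
  page_differential (@relations W) (@dtotal W) (@columns_le W) r p x y.

(* Main.v *)
(** The relation refines H G G' says exactly that the flat of G' is contained in the
    flat of G: a vector lies in the flat of a set of colors iff it is constant on the
    components of the corresponding edges, and the indicator of a component of G' lies
    in the flat of G'. Together with submodularity of the codimension this determines
    the differentials of the relevant generators: removing the embedded color is the only
    way to keep the flat, so d a_124 = - a_12, d a_235 = - a_23 and
    d a_1234 = a_123 = d a_1235.

    Now d_mu (a_1|a_2|a_3) = - a_12|a_3 - a_1|a_23, and the correction terms
    - a_124|a_3 - a_1|a_235 cancel this under d_W. What remains of the total differential
    is their d_mu, namely the one-vertex class of - a_1234 + a_1235, which is itself a
    cycle. *)

Require Import Defs.
From HB Require Import structures.
From mathcomp Require Import all_boot all_order all_fingroup all_algebra.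
From mathcomp Require Import reals complex.
From mathcomp Require Import freeg.
From mathcomp Require Import zify.

Set Implicit Arguments.
Unset Strict Implicit.
Unset Printing Implicit Defensive.

Import Order.TTheory GRing.Theory Num.Theory.
Local Open Scope ring_scope.

(** * Flats and refinement *)

Section Codimension.
Variables (C : fieldType) (l : nat).
Implicit Types U V : {vspace 'rV[C]_l}.

Lemma codimS U V : (U <= V)%VS -> (codim V <= codim U)%N.
Proof. by move=> UV; rewrite /codim leq_sub2l ?dimvS. Qed.

Lemma codim_eq U V : (U <= V)%VS -> (codim U <= codim V)%N -> U = V.
Proof.
move=> UV le_codim; apply/eqP; rewrite eqEdim UV /=.
by rewrite -(leq_sub2lE _ (dimvS (subvf V))).
Qed.

(** Follows from the dimension formula for a sum and an intersection; the bounds by the ambient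
    dimension make the truncated subtractions in [codim] exact. *)
Lemma codim_cap U V : (codim (U :&: V) <= codim U + codim V)%N.
Proof.
rewrite /codim leq_subLR addnA.
have := dimv_sum_cap U V; have := dimvS (subvf (U + V)%VS).
have := dimvS (subvf U); have := dimvS (subvf V).
move: (\dim _) (\dim _) (\dim _) (\dim _) (\dim _) => a b c d e; lia.
Qed.

Variables (L : finType) (X : L -> {vspace 'rV[C]_l}).
Implicit Types (s t G : {set L}) (i j k : L).

Lemma flatU s t : flat X (s :|: t) = (flat X s :&: flat X t)%VS.
Proof.
apply/eqP; rewrite eqEsubv; apply/andP; split.
  by rewrite subv_cap; apply/andP; split; apply/subv_bigcapP=> c cs;
    apply: bigcapv_inf (subvv _); rewrite inE cs ?orbT.
apply/subv_bigcapP=> c; rewrite inE => /orP[] cs.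
  by apply: subv_trans (capvSl _ _) _; apply: bigcapv_inf (subvv _).
by apply: subv_trans (capvSr _ _) _; apply: bigcapv_inf (subvv _).
Qed.

Lemma flat1 i : flat X [set i] = X i.
Proof. by rewrite /flat big_set1. Qed.

Lemma flatS s t : s \subset t -> (flat X t <= flat X s)%VS.
Proof. by move/setUidPr <-; rewrite flatU capvSl. Qed.

Lemma flat_le s i : i \in s -> (flat X s <= X i)%VS.
Proof. by move=> si; apply: bigcapv_inf (subvv _). Qed.

Lemma flatD1E s i : i \in s -> (flat X (s :\ i) == flat X s) = (flat X (s :\ i) <= X i)%VS.
Proof.
move=> si; rewrite -{2}(setD1K si) flatU flat1 eq_sym.
apply/eqP/idP => [<-|le_i]; first exact: capvSl.
by apply/capv_idPr.
Qed.

(** If dropping [i] keeps the flat of the union, then codim [s] + codim [t] is the codimension of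
    the flat of [(s :\ i) :|: t], which by subadditivity is at most codim [s :\ i] + codim [t].
    Hence codim [s] is at most codim [s :\ i], and the inclusion of flats becomes an equality. *)
Lemma multiplicative_flatD1 s t i : Defs.multiplicative X s t -> i \notin t ->
  flat X ((s :|: t) :\ i) = flat X (s :|: t) -> flat X (s :\ i) = flat X s.
Proof.
move=> mul_st it eq_flat; apply/esym/codim_eq; first exact/flatS/subsetDl.
rewrite -(leq_add2r (codim (flat X t))) mul_st -eq_flat setDUl.
have /setDidPl-> : [disjoint t & [set i]] by rewrite disjoint_sym disjoints1.
by rewrite flatU codim_cap.
Qed.

End Codimension.

(** * Refinement as inclusion of flats *)

Section Refinement.
Variables (l : nat) (L : finType) (H : colored_hypergraph l L) (C : fieldType).
Implicit Types (S T : {set edge_index H}) (G : {set L}) (e f : edge_index H).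

Lemma mem_hyperplane (i j : 'I_l) (v : 'rV[C]_l) :
  (v \in hyperplane C i j) = (v ord0 i == v ord0 j).
Proof. by rewrite memv_ker lfunE /= subr_eq0. Qed.

Definition constant_on (A : {set 'I_l}) (v : 'rV[C]_l) :=
  {in A &, forall i j, v ord0 i = v ord0 j}.

Lemma mem_nu (A : {set 'I_l}) (v : 'rV[C]_l) : v \in nu C A <-> constant_on A v.
Proof.
rewrite /nu memvE; split=> [/subv_bigcapP vA i j iA jA|vA].
  by have /subv_bigcapP/(_ _ jA) := vA _ iA; rewrite -memvE mem_hyperplane => /eqP.
apply/subv_bigcapP=> i iA; apply/subv_bigcapP=> j jA.
by rewrite -memvE mem_hyperplane (vA i j).
Qed.

Lemma mem_flat G (v : 'rV[C]_l) :
  v \in flat (arrangement_of H C) G <->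
  {in edges_of_colors H G, forall e, constant_on (edge e) v}.
Proof.
rewrite memvE; split=> [/subv_bigcapP vG e|vG].
  rewrite inE => /vG/subv_bigcapP/(_ e (eqxx _)).
  by rewrite -memvE => /mem_nu.
apply/subv_bigcapP=> c cG; apply/subv_bigcapP=> e /eqP ec.
by rewrite -memvE; apply/mem_nu/vG; rewrite inE ec.
Qed.

Lemma edge_neq0 e : exists i, i \in edge e.
Proof. by apply/card_gt0P/ltnW/edge_ge2. Qed.

Lemma mem_vertices S e i : e \in S -> i \in edge e -> i \in vertices S.
Proof. by move=> eS ie; apply/bigcupP; exists e. Qed.

Lemma meeting_sym S : symmetric (meeting S).
Proof. by move=> e f; rewrite /meeting /= setIC andbCA. Qed.

Lemma meetingI S e f i : e \in S -> f \in S -> i \in edge e -> i \in edge f ->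
  meeting S e f.
Proof. by rewrite /meeting /= => -> -> ie jf; apply/set0Pn; exists i; rewrite inE ie. Qed.

(** Edges are nonempty and edges sharing a vertex meet, so chains between vertices and chains
    between edges yield each other. The form with edges suits induction on paths. *)
Lemma connected_edgesP S :
  reflect {in S &, forall e f, connect (meeting S) e f} (connected_edges S).
Proof.
apply: (iffP forall_inP) => [con e f eS fS|con i /bigcupP[e eS ie]].
  have [i ie] := edge_neq0 e; have [j jf] := edge_neq0 f.
  have /forall_inP/(_ _ (mem_vertices fS jf)) := con _ (mem_vertices eS ie).
  case/exists_inP=> e' e'S /exists_inP[f' f'S /and3P[ie' jf' e'f']].
  apply: connect_trans (connect1 (meetingI eS e'S ie ie')) (connect_trans e'f' _).
  exact: connect1 (meetingI f'S fS jf' jf).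
apply/forall_inP=> j /bigcupP[f fS jf].
apply/exists_inP; exists e => //; apply/exists_inP; exists f => //.
by rewrite ie jf con.
Qed.

(** Along a chain of edges the value is carried through a vertex common to consecutive edges. *)
Lemma connected_edges_constant S (v : 'rV[C]_l) : connected_edges S ->
  {in S, forall e, constant_on (edge e) v} -> constant_on (vertices S) v.
Proof.
move=> /connected_edgesP con cst i j /bigcupP[e eS ie] /bigcupP[f fS jf].
have /connectP[p] := con e f eS fS.
elim: p e i eS ie {con} => [|g p IHp] e i eS ie /= => [_ def_f|].
  by apply: (cst e) => //; rewrite -def_f.
case/andP=> /and3P[_ gS /set0Pn[k /setIP[ke kg]]] pathp last_p.
by rewrite (cst e eS i k ie ke); apply: IHp kg pathp last_p.
Qed.

Lemma exists_component S e : e \in S -> exists2 T, is_component S T & e \in T.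
Proof.
move=> eS; have con1: connected_edges [set e].
  by apply/connected_edgesP=> _ _ /set1P-> /set1P->; apply: connect0.
have [|T maxT] := @maxset_exists _ (fun T => (T \subset S) && connected_edges T) [set e].
  by rewrite sub1set eS.
by rewrite sub1set; exists T.
Qed.

(** Adding to [T] an edge that meets its vertex set keeps it connected, so maximality puts the edge
    in [T]. *)
Lemma component_edge S T e i : is_component S T -> e \in S -> i \in edge e ->
  i \in vertices T -> e \in T.
Proof.
move=> /maxsetP[/andP[TS /connected_edgesP con] maxT] eS ie /bigcupP[f fT if_].
suff <- : e |: T = T by rewrite setU11.
apply: maxT (subsetUr _ _); rewrite subUset sub1set eS TS /=.
set T' := e |: T.
have mono g h : connect (meeting T) g h -> connect (meeting T') g h.
  apply: connect_sub => {}g {}h /and3P[gT hT gh]; apply: connect1.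
  by rewrite /meeting /= !inE gT hT gh !orbT.
(* All edges of the enlarged family are linked to [f], the edge of [T] through [i]; symmetry then
   links any two of them. *)
have toward g : g \in T' -> connect (meeting T') g f.
  case/setU1P=> [->|gT]; last by apply/mono/con.
  by apply/connect1/(@meetingI _ _ _ i) => //; rewrite !inE ?eqxx ?fT ?orbT.
apply/connected_edgesP=> g h gT' hT'.
apply: connect_trans (toward g gT') _.
by rewrite (sym_connect_sym (meeting_sym T')) toward.
Qed.

(** A test vector: it lies in the flat of [G] exactly when no edge with color in [G] has vertices
    both inside and outside [A]. *)
Definition indicator (A : {set 'I_l}) : 'rV[C]_l := \row_i (i \in A)%:R.

Lemma indicatorE (A : {set 'I_l}) (i j : 'I_l) :
  (indicator A ord0 i = indicator A ord0 j) <-> (i \in A) = (j \in A).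
Proof.
rewrite !mxE; split=> [|-> //].
by case: (i \in A); case: (j \in A) => // /eqP; rewrite ?oner_eq0 // eq_sym oner_eq0.
Qed.

Lemma refinesP G G' :
  reflect (flat (arrangement_of H C) G' <= flat (arrangement_of H C) G)%VS (refines H G G').
Proof.
apply: (iffP forall_inP) => [ref|sub T].
  apply/subvP=> v /mem_flat vG'; apply/mem_flat=> e eG i j ie je.
  have [T compT eT] := exists_component eG.
  have /exists_inP[T' /maxsetP[/andP[T'G' conT'] _] /subsetP TT'] := ref T compT.
  apply: (connected_edges_constant conT') => [f fT'||].
  - exact/vG'/(subsetP T'G').
  - exact/TT'/(mem_vertices eT).
  - exact/TT'/(mem_vertices eT).
case/maxsetP=> /andP[/subsetP TG conT] _.
have constT A : {in edges_of_colors H G', forall e, constant_on (edge e) (indicator A)} ->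
    {in vertices T &, forall i j, (i \in A) = (j \in A)}.
  move=> /mem_flat/(subvP sub)/mem_flat cstA i j iT jT; apply/indicatorE.
  by apply: (connected_edges_constant conT) => // e /TG/cstA.
(* An empty component has no vertices, so any component for [G'] will do; one is obtained by
   enlarging the empty family. *)
have [->|[e eT]] := set_0Vmem T.
  have [|T' maxT' _] := @maxset_exists _
    (fun T => (T \subset edges_of_colors H G') && connected_edges T) set0.
    by rewrite sub0set; apply/connected_edgesP=> e f; rewrite inE.
  by apply/exists_inP; exists T' => //; apply/subsetP=> i /bigcupP[e]; rewrite inE.
have /card_gt1P[i [j [ie je neq_ij]]] := edge_ge2 e.
have iT := mem_vertices eT ie; have jT := mem_vertices eT je.
(* If no edge for [G'] contained [i], the indicator of [i] would lie in the flat of [G'], although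
   it separates [i] from [j] on the edge [e]. *)
have /bigcupP[f fG' if_] : i \in vertices (edges_of_colors H G').
  apply: contraNT neq_ij => iG'.
  have := constT [set i]; rewrite eq_sym => /(_ _ i j iT jT).
  rewrite !inE eqxx => <- // f fG' x y xf yf.
  apply/indicatorE; rewrite !inE; have neq z : z \in edge f -> (z == i) = false.
    by move=> zf; apply: contraNF iG' => /eqP <-; apply: mem_vertices zf.
  by rewrite !neq.
have [T' compT' fT'] := exists_component fG'.
apply/exists_inP; exists T' => //; apply/subsetP=> x xT.
(* No edge for [G'] crosses the boundary of its component [T'], so the indicator of [vertices T'] is
   an admissible test vector; it is constant on [vertices T] and equals 1 at [i]. *)
rewrite (constT (vertices T') _ x i) ?(mem_vertices fT') // => g gG' y z yg zg.
apply/indicatorE; apply/idP/idP => [yT'|zT'].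
  exact: mem_vertices (component_edge compT' gG' yg yT') zg.
exact: mem_vertices (component_edge compT' gG' zg zT') yg.
Qed.

End Refinement.

(** * The relative atomic complex *)

Section AtomicComplex.
Variables (C : fieldType) (l : nat) (disp : Order.disp_t).
Variables (L : finOrderType disp) (X : L -> {vspace 'rV[C]_l}).
Implicit Types (s t : {set L}) (i j k : L).

(** Expresses that the differential of the generator of [s] has a single term, the one omitting
    [k]. *)
Definition sole_redundant s k :=
  k \in s /\ {in s, forall i, (flat X (s :\ i) == flat X s) = (i == k)}.

(** The only surviving term omits the greatest element, whose position counted from 1 is the size of
    [s]. *)
Lemma atomic_diff_max s k : sole_redundant s k -> {in s, forall i, (i <= k)%O} ->
  atomic_diff X s = (-1) ^+ #|s| *: << s :\ k >>.
Proof.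
move=> [ks red_k] max_k; rewrite /atomic_diff (big_pred1 k) => [|i] /=.
  rewrite /position; congr (_ ^+ #|pred_of_set _| *: _).
  by apply/setP=> i; rewrite inE; case: (boolP (i \in s)) => //= /max_k.
by have [/red_k|/memPnC/(_ _ ks)] := boolP (i \in s); rewrite //= eq_sym => /negPf.
Qed.

(** The three hypotheses say which of the three colors contains the flat of the other two. The two
    negative ones also force the colors to be distinct, since a flat lies in each of its members. *)
Lemma sole_redundant_embedded i j k :
  (flat X [set i; j] <= X k)%VS -> ~~ (flat X [set j; k] <= X i)%VS ->
  ~~ (flat X [set i; k] <= X j)%VS -> sole_redundant [set i; j; k] k.
Proof.
move=> ij_k jk_i ik_j; split; first by rewrite !inE eqxx orbT.
have ij: i != j.
  apply: contraNneq jk_i => ->; apply: flat_le.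
  by rewrite !inE eqxx.
have ik: i != k.
  apply: contraNneq jk_i => ->; apply: flat_le.
  by rewrite !inE eqxx orbT.
have jk: j != k.
  apply: contraNneq ik_j => ->; apply: flat_le.
  by rewrite !inE eqxx orbT.
have Dk : [set i; j; k] :\ k = [set i; j].
  by rewrite setUC setU1K // !inE negb_or ![k == _]eq_sym ik.
have Dj : [set i; j; k] :\ j = [set i; k].
  by rewrite setUAC setUC setU1K // !inE negb_or jk [j == i]eq_sym ij.
have Di : [set i; j; k] :\ i = [set j; k].
  by rewrite -setUA setU1K // !inE negb_or ij.
move=> x xs; rewrite flatD1E //; move: xs; rewrite !inE -orbA.
case/or3P=> /eqP->.
- by rewrite Di (negPf jk_i) (negPf ik).
- by rewrite Dj (negPf ik_j) (negPf jk).
- by rewrite Dk ij_k eqxx.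
Qed.

(** By multiplicativity an element of [s] redundant in the union is already redundant in [s]. The
    new color [i] cannot be redundant, since then [X i] would be the flat of the empty set, the
    whole space. *)
Lemma sole_redundantU1 s k i : sole_redundant s k -> i \notin s ->
  Defs.multiplicative X s [set i] -> X i != fullv -> sole_redundant (s :|: [set i]) k.
Proof.
move=> [ks red_k] i_s mul_si Xi; split; first by rewrite inE ks.
have mul_is : Defs.multiplicative X [set i] s.
  by rewrite /Defs.multiplicative addnC mul_si setUC.
move=> j; rewrite !inE => /orP[js|/eqP->{j}].
  have ji : j \notin [set i] by rewrite inE; apply: contraNneq i_s => <-.
  apply/eqP/idP => [/(multiplicative_flatD1 mul_si ji)/eqP|]; first by rewrite red_k.
  rewrite -red_k // setDUl => /eqP.
  have /setDidPl-> : [disjoint [set i] & [set j]] by rewrite disjoint_sym disjoints1.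
  by rewrite !flatU => ->.
have -> : (i == k) = false by apply: contraNF i_s => /eqP->.
apply: contraNF Xi => /eqP; rewrite setUC => /(multiplicative_flatD1 mul_is i_s).
by rewrite setDv flat1 => <-; rewrite /flat big_set0.
Qed.

Lemma atomic_mulE s t : Defs.multiplicative X s t ->
  atomic_mul X s t = (-1) ^+ shuffle_inversions s t *: << s :|: t >>.
Proof. by rewrite /atomic_mul => ->; rewrite eqxx. Qed.

Lemma shuffle_inversions_eq0 s t : (forall i j, i \in s -> j \in t -> (i <= j)%O) ->
  shuffle_inversions s t = 0%N.
Proof.
move=> st; apply/eqP; rewrite cards_eq0; apply/eqP/setP=> -[i j]; rewrite !inE /=.
by apply/and3P=> -[/st st' /st']; rewrite leNgt => /negPf->.
Qed.

Lemma atomic_diff1 i : X i != fullv -> atomic_diff X [set i] = 0.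
Proof.
move=> Xi; rewrite /atomic_diff big1 // => j /andP[/set1P->].
by rewrite setDv flat1 /flat big_set0 eq_sym (negPf Xi).
Qed.

Lemma sign_atomic_deg s : (-1) ^ atomic_deg X s = (-1) ^+ #|s| :> rat.
Proof.
rewrite /atomic_deg expfzDr ?oppr_eq0 ?oner_eq0 // -exprnN -exprnP exprM sqrrN expr1n mul1r.
by rewrite invr_sign.
Qed.

(** The parity of the desuspended degree, which governs Koszul signs: generators of single colors
    are even there. *)
Lemma sign_atomic_degB1 s : (-1) ^ (atomic_deg X s - 1) = (-1) ^+ #|s|.+1 :> rat.
Proof. by rewrite expfzDr ?oppr_eq0 ?oner_eq0 // sign_atomic_deg exprSr. Qed.

(** The sum of the three codimensions equals that of the total flat, so both uses of subadditivity,
    for [t] with [u] and for [s] with [t :|: u], must be equalities. *)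
Lemma multiplicativeA s t u : Defs.multiplicative X s t -> Defs.multiplicative X (s :|: t) u ->
  Defs.multiplicative X t u /\ Defs.multiplicative X s (t :|: u).
Proof.
rewrite /Defs.multiplicative -setUA => st stu.
have := codim_cap (flat X t) (flat X u); have := codim_cap (flat X s) (flat X (t :|: u)).
rewrite -!flatU; lia.
Qed.

End AtomicComplex.

(** * The bicomplex *)

Section FreeLift.
Variables (R : nzRingType) (K : choiceType) (M : lmodType R).
Implicit Types (f g : K -> M) (x : {freeg K / R}).

Lemma fglift0 f : fglift f 0 = 0.
Proof. by rewrite -[X in fglift f X](subrr 0) lift_is_additive subrr. Qed.

Lemma fgliftD f x y : fglift f (x + y) = fglift f x + fglift f y.
Proof. by rewrite -[y in LHS]opprK -[- y]sub0r !lift_is_additive fglift0 sub0r opprK. Qed.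

Lemma fglift_sumE f x : fglift f x = \sum_(c <- dom x) coeff c x *: f c.
Proof.
rewrite -[in LHS](freeg_sumE x); elim/big_ind2: _ => [|u a v b <- <-|c _].
- exact: fglift0.
- exact: fgliftD.
- exact: liftU.
Qed.

Lemma fglift_is_linear f : linear (fglift f).
Proof.
move=> a x y; rewrite fgliftD; congr (_ + _).
rewrite [in RHS]fglift_sumE scaler_sumr {1}/GRing.scale /= /fgscale.
elim/big_ind2: _ => [|u b v c <- <-|c _]; [exact: fglift0 | exact: fgliftD |].
by rewrite liftU scalerA.
Qed.

HB.instance Definition _ f :=
  GRing.isLinear.Build R {freeg K / R} M _ (fglift f) (fglift_is_linear f).

Lemma fglift1 f c : fglift f << c >> = f c.
Proof. by rewrite liftU scale1r. Qed.

End FreeLift.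

(** * Relations, columns and differentials of bar words *)

Section Bicomplex.
Variable W : dga_on_basis.
Local Notation M := (decorated_module W).
Implicit Types (x y z : M) (a b c : gen W).

Lemma relations_closedD x y : relations x -> relations y -> relations (x + y).
Proof.
elim=> [|k r u rel_r _ IHu] rel_y; first by rewrite add0r.
by rewrite -addrA; apply: relationsD rel_r (IHu rel_y).
Qed.

Lemma relations_closedZ k x : relations x -> relations (k *: x).
Proof.
elim=> [|k' r u rel_r _ IHu]; first by rewrite scaler0; apply: relations0.
by rewrite scalerDr scalerA; apply: relationsD.
Qed.

Lemma relations_relator x : relator x -> relations x.
Proof.
move=> rel_x; rewrite -[x]scale1r -[X in relations X]addr0.
exact: relationsD rel_x (relations0 _).
Qed.

(** Allows a congruence modulo the relations to be checked one basis element of a product at a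
    time. *)
Lemma relations_fglift (f g : gen W -> M) w :
  (forall c, relations (f c - g c)) -> relations (fglift f w - fglift g w).
Proof.
move=> rel_fg; rewrite !fglift_sumE -sumrB.
elim/big_ind: _ => [|u v|c _]; [exact: relations0 | exact: relations_closedD |].
by rewrite -scalerBr; apply: relations_closedZ.
Qed.

Lemma columns_le0 p : columns_le p (0 : M).
Proof. by move=> d; rewrite dom0. Qed.

Lemma columns_leD p x y : columns_le p x -> columns_le p y -> columns_le p (x + y).
Proof.
by move=> px py d /domD_subset; rewrite mem_cat => /orP[/px|/py].
Qed.

Lemma columns_leZ p k x : columns_le p x -> columns_le p (k *: x).
Proof. by move=> px d /domZ_subset/px. Qed.

Lemma columns_leW p q x : p <= q -> columns_le p x -> columns_le q x.
Proof. by move=> pq px d /px/le_trans; apply. Qed.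

Lemma columns_le_fglift p (f : gen W -> M) w :
  (forall c, columns_le p (f c)) -> columns_le p (fglift f w).
Proof.
move=> pf; rewrite fglift_sumE.
elim/big_ind: _ => [|u v|c _]; [exact: columns_le0 | exact: columns_leD |].
exact: columns_leZ.
Qed.

Lemma columns_le_filtration p x : columns_le p x -> filtration (@relations W) (@columns_le W) p x.
Proof. by exists x => //; rewrite subrr; apply: relations0. Qed.

(** Discharges the default value of [decorate], so that the differentials can be evaluated on basis
    elements. *)
Lemma decorateE n (g : digraph n) (b : labelling W n) (acg : acyclic g) :
  decorate g b = << (Tagged (fun n => ({g : digraph n | acyclic g} * labelling W n)%type)
            (exist _ g acg : {g : digraph n | acyclic g}, b) : decorated_graph W) >>.
Proof. by rewrite /decorate (insubT (@acyclic n) acg). Qed.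

Lemma dW_decorate n (g : digraph n) (b : labelling W n) :
  acyclic g -> dW (decorate g b) = dW_gen g b.
Proof. by move=> acg; rewrite (decorateE b acg) /dW fglift1. Qed.

Lemma dmu_decorate n (g : digraph n) (b : labelling W n) :
  acyclic g -> dmu (decorate g b) = dmu_gen g b.
Proof. by move=> acg; rewrite (decorateE b acg) /dmu fglift1. Qed.

Lemma columns_le_decorate n (g : digraph n) (b : labelling W n) :
  columns_le #|g|%:Z (decorate g b).
Proof.
have [acg|nacg] := boolP (acyclic g); last by rewrite /decorate insubN //; apply: columns_le0.
by rewrite (decorateE b acg) => d; rewrite domU1 inE => /eqP->.
Qed.

HB.instance Definition _ := GRing.Linear.copy (@dW W) (fglift _).
HB.instance Definition _ := GRing.Linear.copy (@dmu W) (fglift _).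

(** * Differentials of words with at most three entries *)

Lemma path_graph1 : path_graph 1 = set0.
Proof. by apply/setP=> -[[[|//] ?] [[|//] ?]]; rewrite !inE. Qed.

Lemma path_graph2 : path_graph 2 = [set (ord0, inord 1)].
Proof.
apply/setP=> -[u v]; rewrite !inE xpair_eqE -!val_eqE /= inordK //.
by case: u v => [[|[|//]] ?] [[|[|//]] ?].
Qed.

Lemma path_graph3 : path_graph 3 = [set (ord0, inord 1); (inord 1, inord 2)].
Proof.
apply/setP=> -[u v]; rewrite !inE !xpair_eqE -!val_eqE /= !inordK //.
by case: u v => [[|[|[|//]]] ?] [[|[|[|//]]] ?].
Qed.

Lemma dW_bar n (b : n.-tuple (gen W)) : dW (bar b) = dW_gen (path_graph n) [ffun i => tnth b i].
Proof. by rewrite dW_decorate ?acyclic_path_graph. Qed.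

Lemma dW_bar_eq0 n (b : n.-tuple (gen W)) :
  (forall k, gdiff (tnth b k) = 0) -> dW (bar b) = 0.
Proof.
by move=> db; rewrite dW_bar /dW_gen big1 // => k _; rewrite ffunE db linear0 scaler0.
Qed.

Lemma dW_bar1 a : dW (bar [tuple a]) = one_vertex (gdiff a).
Proof.
rewrite dW_bar /dW_gen big_ord1 big1 => [|[] //]; rewrite expr0z scale1r ffunE.
rewrite /one_vertex !fglift_sumE; apply: eq_bigr => c _; congr (_ *: decorate _ _).
by apply/ffunP=> i; rewrite !ffunE !ord1.
Qed.

Lemma dW_bar2 a b : dW (bar [tuple a; b]) =
  fglift (fun c => bar [tuple c; b]) (gdiff a) +
  (-1) ^ (gdeg a - 1) *: fglift (fun c => bar [tuple a; c]) (gdiff b).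
Proof.
rewrite dW_bar /dW_gen !big_ord_recr big_ord0 /= add0r.
rewrite (big_pred0 _ _ _ _) // expr0z scale1r; congr (_ + _ *: _).
- rewrite ffunE !fglift_sumE; apply: eq_bigr => c _; congr (_ *: decorate _ _).
  by apply/ffunP=> -[[|[|//]] ?]; rewrite !ffunE.
- by rewrite (big_pred1 ord0) ?ffunE // => -[[|[|//]] ?].
- rewrite ffunE !fglift_sumE; apply: eq_bigr => c _; congr (_ *: decorate _ _).
  by apply/ffunP=> -[[|[|//]] ?]; rewrite !ffunE.
Qed.

Lemma dmu_bar1 a : dmu (bar [tuple a]) = 0.
Proof. by rewrite dmu_decorate ?acyclic_path_graph. Qed.

Lemma to_front01 m : to_front (ord0 : 'I_m.+2) (inord 1) = 1%g.
Proof. by rewrite /to_front tperm1 mul1g perm1 tperm1. Qed.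

Lemma relabel1 n (g : digraph n) : relabel 1%g g = g.
Proof.
rewrite /relabel -[RHS]imset_id; apply: eq_imset => -[u v] /=; by rewrite !perm1.
Qed.

Lemma permute1 n (b : labelling W n) : permute 1%g b = b.
Proof. by apply/ffunP=> i; rewrite ffunE invg1 perm1. Qed.

Lemma koszul1 n (b : labelling W n) : koszul 1%g b = 1.
Proof. by rewrite /koszul big1 // => p /andP[p12]; rewrite !perm1 ltnNge ltnW. Qed.

Lemma mu01 m (g : digraph m.+2) (b : labelling W m.+2) :
  mu (ord0, inord 1) g b = contract_front g b.
Proof. by rewrite /mu to_front01 koszul1 scale1r relabel1 permute1. Qed.

Lemma dmu_bar2 a b : dmu (bar [tuple a; b]) = (-1) ^ gdeg a *: one_vertex (gmul a b).
Proof.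
rewrite dmu_decorate ?acyclic_path_graph //= path_graph2 big_set1 mu01.
rewrite /contract_front !ffunE /tnth /= inordK //=; congr (_ *: _).
rewrite /one_vertex !fglift_sumE; apply: eq_bigr => c _; congr (_ *: _).
have -> : contract_graph [set (ord0, inord 1)] = path_graph 1.
  by rewrite /contract_graph setDv imset0 path_graph1.
by congr decorate; apply/ffunP=> i; rewrite !ffunE !ord1.
Qed.

Lemma contract_graph_path m (e : 'I_m.+2 * 'I_m.+2) : e != (ord0, inord 1) ->
  contract_graph [set (ord0, inord 1); e] = [set (squash e.1, squash e.2)].
Proof. by move=> ne; rewrite /contract_graph setU1K ?imset_set1 // inE eq_sym. Qed.

(** A factor of the Koszul sign is 1 as soon as one of its two labels is even, and every inversion
    involves the even label at [i]. *)
Lemma koszul_even n (s : 'S_n) (b : labelling W n) (i : 'I_n) :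
  (-1) ^ (gdeg (b i) - 1) = 1 :> rat ->
  (forall j k : 'I_n, (j < k)%N -> (s k < s j)%N -> j = i \/ k = i) -> koszul s b = 1.
Proof.
move=> even_i inv_i; rewrite /koszul big1 // => -[j k] /= /andP[jk skj].
case: (inv_i j k jk skj) => ->; first by rewrite -exprz_exp even_i exp1rz.
by rewrite mulrC -exprz_exp even_i exp1rz.
Qed.

(** Coinvariance under the transposition of the two vertices, without sign since [a] is even after
    desuspension. It brings the reversed edge left by a contraction back to a bar word. *)
Lemma bar_swap a b : (-1) ^ (gdeg a - 1) = 1 :> rat ->
  relations (decorate [set (inord 1, ord0)] [ffun k : 'I_2 => if k == ord0 then b else a]
    - bar [tuple a; b]).
Proof.
move=> even_a; apply: relations_relator.
set s : 'S_2 := tperm ord0 (inord 1).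
have := Coinvariance s [ffun i => tnth [tuple a; b] i] (acyclic_path_graph 2).
rewrite (@koszul_even _ _ _ ord0) ?ffunE //; last first.
  by case=> [[|[|//]] ?] [[|[|//]] ?] //; left; apply: val_inj.
rewrite scale1r path_graph2 /relabel imset_set1 /= tpermL tpermR.
congr (relator (decorate _ _ - _)); last by rewrite /bar path_graph2.
apply/ffunP=> i; rewrite !ffunE tpermV.
case: tpermP => [->|->|i0 i1].
- by rewrite /tnth /= inordK.
- by rewrite -val_eqE /= inordK.
- by case: i i0 i1 => [[|[|//]] ?] i0 i1; [case: i0 | case: i1];
    apply: val_inj; rewrite /= ?inordK.
Qed.

(** Contracting the second edge moves the vertex [a] behind the other two; no sign
    arises as [a] is even in the desuspension. *)
Lemma dmu_bar3 a b c : (-1) ^ (gdeg a - 1) = 1 :> rat ->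
  relations (dmu (bar [tuple a; b; c]) -
    ((-1) ^ gdeg a *: fglift (fun w => bar [tuple w; c]) (gmul a b) +
     (-1) ^ gdeg b *: fglift (fun w => bar [tuple a; w]) (gmul b c))).
Proof.
move=> even_a; rewrite dmu_decorate ?acyclic_path_graph //= path_graph3.
have ne01 : ord0 != inord 1 :> 'I_3 by rewrite -val_eqE /= inordK.
have ne02 : ord0 != inord 2 :> 'I_3 by rewrite -val_eqE /= inordK.
have ne12 : inord 1 != inord 2 :> 'I_3 by rewrite -val_eqE /= !inordK.
rewrite big_setU1 ?big_set1 /=; last by rewrite inE xpair_eqE (negPf ne01).
rewrite mu01 /contract_front contract_graph_path; last first.
  by rewrite xpair_eqE eq_sym (negPf ne01).
(* For the second edge, [s] is the 3-cycle sending the vertices 1, 2, 0 to 0, 1, 2. *)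
rewrite !ffunE /mu /=; set s := to_front _ _.
have s0 : s ord0 = inord 2.
  by rewrite /s /to_front permM tpermR (tpermD ne12 ne02) tpermR.
have s1 : s (inord 1) = ord0.
  by rewrite /s /to_front permM tpermL (tpermD ne12 ne02) tpermD // eq_sym.
have s2 : s (inord 2) = inord 1.
  by rewrite /s /to_front permM (tpermD ne12 ne02) tpermL.
(* Both inversions of [s] involve vertex 0, which carries the even label [a]. *)
rewrite (@koszul_even _ _ _ ord0) ?ffunE // ?scale1r; last first.
  move=> j k; case: (eqVneq j ord0) => [|j0]; [by left|].
  case: (eqVneq k ord0) => [|k0 jk]; [by right|].
  have -> : j = inord 1.
    apply: val_inj; rewrite /= inordK //.
    by case: j k j0 k0 jk => [[|[|[|//]]] ?] [[|[|[|//]]] ?].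
  by rewrite s1 ltnNge leqNgt.
have rel_s : relabel s [set (ord0, inord 1); (inord 1, inord 2)]
    = [set (ord0, inord 1); (inord 2, ord0)].
  by rewrite /relabel imsetU1 imset_set1 /= s0 s1 s2 setUC.
rewrite /contract_front rel_s contract_graph_path; last first.
  by rewrite xpair_eqE eq_sym (negPf ne02).
have inv0 : (s^-1)%g ord0 = inord 1 by rewrite -s1 permK.
have inv1 : (s^-1)%g (inord 1) = inord 2 by rewrite -s2 permK.
have inv2 : (s^-1)%g (inord 2) = ord0 by rewrite -s0 permK.
rewrite !ffunE inv0 inv1 /tnth /= !inordK //=.
rewrite opprD addrACA -!scalerBr; apply: relations_closedD; apply: relations_closedZ.
  (* Contracting the first edge gives the bar word itself. *)
  apply: relations_fglift => w; rewrite /bar path_graph2.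
  set x := decorate _ _; set y := decorate _ _; suff -> : x = y.
    by rewrite subrr; apply: relations0.
  rewrite /x /y /squash !inordK //=; congr (decorate [set (_, _)] _).
    by apply: val_inj; rewrite /= inordK.
  by apply/ffunP=> -[[|[|//]] ?]; rewrite !ffunE.
(* Contracting the second edge leaves an arrow from vertex 1, labelled [a], to vertex 0, labelled by
   the product: the situation of [bar_swap]. *)
apply: relations_fglift => w.
have := bar_swap w even_a; congr (relations (decorate [set (_, _)] _ - _)).
- by rewrite /squash !inordK.
- by apply: val_inj; rewrite /= inordK.
apply/ffunP=> -[[|[|//]] k_lt]; rewrite !ffunE //=.
have -> : fintype.lift ord0 (Ordinal k_lt) = inord 2.
  by apply: val_inj; rewrite /= inordK.
by rewrite inv2.
Qed.

Lemma columns_le_bar n (b : n.-tuple (gen W)) : columns_le #|path_graph n|%:Z (bar b).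
Proof. exact: columns_le_decorate. Qed.

Lemma columns_le_bar1 (b : 1.-tuple (gen W)) : columns_le 0 (bar b).
Proof. by have := @columns_le_bar 1 b; rewrite path_graph1 cards0. Qed.

Lemma columns_le_bar2 (b : 2.-tuple (gen W)) : columns_le 1 (bar b).
Proof. by have := @columns_le_bar 2 b; rewrite path_graph2 cards1. Qed.

Lemma columns_le_bar3 (b : 3.-tuple (gen W)) : columns_le 2 (bar b).
Proof.
by have := @columns_le_bar 3 b; rewrite path_graph3 cards2 xpair_eqE -val_eqE /= inordK.
Qed.

End Bicomplex.

(** * The second differential *)

Theorem theorem4p10 (R : realType) (l : nat) (disp : Order.disp_t)
    (L : finOrderType disp) (X : L -> {vspace 'rV[R[i]]_l})
    (H : colored_hypergraph l L)
    (X_arrangement : subspace_arrangement X)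
    (X_braid : embedded_in_braid X)
    (H_corresponds : forall c, arrangement_of H R[i] c = X c)
    (no_refinement : forall c c' : L, c != c' -> ~~ refines H [set c] [set c'])
    (c1 c2 c3 c4 c5 : L)
    (massey : massey_color_system H R[i] c1 c2 c3 c4 c5)
    (c12 : (c1 < c2)%O) (c23 : (c2 < c3)%O) (c34 : (c3 < c4)%O) (c45 : (c4 < c5)%O) :
  let D := relative_atomic_complex X in
  let a (s : {set L}) : {freeg (gen D) / rat} := << s >> in
  sinha_walter_d 2 2
    (@bar D 3 [tuple [set c1]; [set c2]; [set c3]])
    (@one_vertex D (- a [set c1; c2; c3; c4] + a [set c1; c2; c3; c5])).
Proof.
move=> D a.

(* Translation of the Massey conditions into statements on the flats of [X] *)
have flat_H G : flat (arrangement_of H R[i]) G = flat X G by apply: eq_bigr.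
have refE G G' : refines H G G' = (flat X G' <= flat X G)%VS.
  by rewrite -!flat_H; apply/(sameP (@refinesP _ _ H R[i] G G'))/idP.
case: massey => mul12 mul12_3 [r4 r1_24 r2_14] [r5 r2_35 r3_25].
rewrite !refE !flat1 in r4 r1_24 r2_14 r5 r2_35 r3_25.
have {}mul12 : Defs.multiplicative X [set c1] [set c2].
  by move: mul12; rewrite /Defs.multiplicative !flat_H.
have {}mul12_3 : Defs.multiplicative X [set c1; c2] [set c3].
  by move: mul12_3; rewrite /Defs.multiplicative !flat_H.
have [mul23 mul1_23] := multiplicativeA mul12 mul12_3.
have c13 := lt_trans c12 c23; have c24 := lt_trans c23 c34; have c35 := lt_trans c34 c45.
have c14 := lt_trans c13 c34; have c25 := lt_trans c24 c45; have c15 := lt_trans c14 c45.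
have neq := (lt_eqF c12, lt_eqF c13, lt_eqF c14, lt_eqF c15, lt_eqF c23, lt_eqF c24,
  lt_eqF c25, lt_eqF c34, lt_eqF c35, lt_eqF c45).
have neq' := (gt_eqF c12, gt_eqF c13, gt_eqF c14, gt_eqF c15, gt_eqF c23, gt_eqF c24,
  gt_eqF c25, gt_eqF c34, gt_eqF c35, gt_eqF c45).
(* Some color differs from [c], and its member would be contained in [X c] if the latter were the
   whole space. *)
have X_proper c : X c != fullv.
  have [c' ne_c'] : exists c', c' != c.
    by case: (eqVneq c1 c) => [<-|]; [exists c2; rewrite neq' | exists c1].
  by apply: contraNneq (X_arrangement _ _ ne_c') => ->; apply: subvf.
have cardsU1r (s : {set L}) i : i \notin s -> #|s :|: [set i]| = #|s|.+1.
  by move=> si; rewrite setUC cardsU1 si.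
have sr4 := sole_redundant_embedded r4 r1_24 r2_14.
have sr5 := sole_redundant_embedded r5 r2_35 r3_25.
have D4 : [set c1; c2; c4] :\ c4 = [set c1; c2].
  by rewrite setUC setU1K // !inE !neq'.
have D5 : [set c2; c3; c5] :\ c5 = [set c2; c3].
  by rewrite setUC setU1K // !inE !neq'.
have flat4 : flat X [set c1; c2; c4] = flat X [set c1; c2].
  by case: sr4 => c4s /(_ _ c4s); rewrite D4 eqxx => /eqP.
have flat5 : flat X [set c2; c3; c5] = flat X [set c2; c3].
  by case: sr5 => c5s /(_ _ c5s); rewrite D5 eqxx => /eqP.
(* Adjoining an embedded color does not change the flat, so multiplicativity is inherited. *)
have mul4 : Defs.multiplicative X [set c1; c2; c4] [set c3].
  by rewrite /Defs.multiplicative (flatU X _ [set c3]) flat4 -flatU.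
have mul5 : Defs.multiplicative X [set c1] [set c2; c3; c5].
  by rewrite /Defs.multiplicative (flatU X [set c1]) flat5 -flatU.
have E4 : [set c1; c2; c4] :|: [set c3] = [set c1; c2; c3; c4] by rewrite setUAC.
have E5 : [set c1] :|: [set c2; c3; c5] = [set c1; c2; c3; c5] by rewrite !setUA.
have sr4' : sole_redundant X [set c1; c2; c3; c4] c4.
  by rewrite -E4; apply: sole_redundantU1 => //; rewrite !inE !neq !neq'.
have sr5' : sole_redundant X [set c1; c2; c3; c5] c5.
  rewrite -E5 setUC; apply: sole_redundantU1 => //; first by rewrite !inE !neq.
  by rewrite /Defs.multiplicative addnC mul5 setUC.
have D4' : [set c1; c2; c3; c4] :\ c4 = [set c1; c2; c3].
  by rewrite setUC setU1K // !inE !neq'.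
have D5' : [set c1; c2; c3; c5] :\ c5 = [set c1; c2; c3].
  by rewrite setUC setU1K // !inE !neq'.

(* Differentials, products and signs of the generators involved *)
have d1 c : gdiff ([set c] : gen D) = 0 by apply: atomic_diff1.
have d4 : gdiff ([set c1; c2; c4] : gen D) = - a [set c1; c2].
  rewrite /= (atomic_diff_max sr4) => [|i]; last first.
    by rewrite !inE -orbA => /or3P[] /eqP->; rewrite ?lexx ?ltW.
  by rewrite D4 !cardsU1r ?inE ?neq' // cards1 -signr_odd scaleN1r.
have d5 : gdiff ([set c2; c3; c5] : gen D) = - a [set c2; c3].
  rewrite /= (atomic_diff_max sr5) => [|i]; last first.
    by rewrite !inE -orbA => /or3P[] /eqP->; rewrite ?lexx ?ltW.
  by rewrite D5 !cardsU1r ?inE ?neq' // cards1 -signr_odd scaleN1r.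
(* The omitted color now stands in position 4 instead of 3, hence the positive sign. *)
have d4' : gdiff ([set c1; c2; c3; c4] : gen D) = a [set c1; c2; c3].
  rewrite /= (atomic_diff_max sr4') => [|i]; last first.
    by rewrite !inE -!orbA => /or4P[] /eqP->; rewrite ?lexx ?ltW.
  by rewrite D4' !cardsU1r ?inE ?neq' // cards1 -signr_odd scale1r.
have d5' : gdiff ([set c1; c2; c3; c5] : gen D) = a [set c1; c2; c3].
  rewrite /= (atomic_diff_max sr5') => [|i]; last first.
    by rewrite !inE -!orbA => /or4P[] /eqP->; rewrite ?lexx ?ltW.
  by rewrite D5' !cardsU1r ?inE ?neq' // cards1 -signr_odd scale1r.
have m12 : gmul ([set c1] : gen D) [set c2] = a [set c1; c2].
  rewrite /= (atomic_mulE mul12) shuffle_inversions_eq0 ?scale1r // => i j.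
  by rewrite !inE => /eqP-> /eqP->; apply: ltW.
have m23 : gmul ([set c2] : gen D) [set c3] = a [set c2; c3].
  rewrite /= (atomic_mulE mul23) shuffle_inversions_eq0 ?scale1r // => i j.
  by rewrite !inE => /eqP-> /eqP->; apply: ltW.
have m4 : gmul ([set c1; c2; c4] : gen D) [set c3] = - a [set c1; c2; c3; c4].
  rewrite /= (atomic_mulE mul4) E4 /shuffle_inversions.
  (* The single inversion is that of [c3] with [c4]; it is the source of the opposite signs in the
     final class. *)
  have -> : [set p : L * L | [&& p.1 \in [set c1; c2; c4], p.2 \in [set c3] & (p.2 < p.1)%O]]
      = [set (c4, c3)].
    apply/setP=> -[i j]; rewrite !inE xpair_eqE /= -orbA.
    apply/and3P/andP => [[/or3P[]/eqP-> /eqP->]|[/eqP-> /eqP->]]; rewrite ?eqxx ?orbT //.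
      by rewrite ltNge ltW.
    by rewrite ltNge ltW.
  by rewrite cards1 expr1 scaleN1r.
have m5 : gmul ([set c1] : gen D) [set c2; c3; c5] = a [set c1; c2; c3; c5].
  rewrite /= (atomic_mulE mul5) E5 shuffle_inversions_eq0 ?scale1r // => i j.
  by rewrite !inE -orbA => /eqP-> /or3P[] /eqP->; apply: ltW.
have sgn1 c : (-1) ^ gdeg ([set c] : gen D) = -1 :> rat.
  by rewrite /= sign_atomic_deg cards1 expr1.
have sgn1' c : (-1) ^ (gdeg ([set c] : gen D) - 1) = 1 :> rat.
  by rewrite /= sign_atomic_degB1 cards1 sqrrN expr1n.
have sgn4 : (-1) ^ gdeg ([set c1; c2; c4] : gen D) = -1 :> rat.
  by rewrite /= sign_atomic_deg !cardsU1r ?inE ?neq' // cards1 -signr_odd.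

(* The corrected word and its total differential *)
pose x := @bar D 3 [tuple [set c1]; [set c2]; [set c3]].
pose x4 := @bar D 2 [tuple [set c1; c2; c4]; [set c3]].
pose x5 := @bar D 2 [tuple [set c1]; [set c2; c3; c5]].
pose p := @bar D 2 [tuple [set c1; c2]; [set c3]].
pose q := @bar D 2 [tuple [set c1]; [set c2; c3]].
pose y4 := @bar D 1 [tuple [set c1; c2; c3; c4]].
pose y5 := @bar D 1 [tuple [set c1; c2; c3; c5]].
pose y := @one_vertex D (- a [set c1; c2; c3; c4] + a [set c1; c2; c3; c5]).
have yE : y = - y4 + y5 by rewrite /y /one_vertex linearD linearN /= !fglift1.
have dWx : dW x = 0.
  by apply: dW_bar_eq0 => -[[|[|[|//]]] ?]; apply: d1.
have dWx4 : dW x4 = - p.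
  by rewrite /x4 dW_bar2 d4 d1 linearN linear0 /= scaler0 addr0 fglift1.
have dWx5 : dW x5 = - q.
  by rewrite /x5 dW_bar2 d5 d1 linearN linear0 /= sgn1' scale1r add0r fglift1.
have dmux4 : dmu x4 = y4.
  by rewrite /x4 dmu_bar2 m4 sgn4 /one_vertex linearN /= fglift1 scaleN1r opprK.
have dmux5 : dmu x5 = - y5.
  by rewrite /x5 dmu_bar2 m5 sgn1 /one_vertex /= fglift1 scaleN1r.
have dmux : relations (dmu x - (- p - q)).
  have := @dmu_bar3 D [set c1] [set c2] [set c3] (sgn1' c1).
  by rewrite m12 m23 !sgn1 !fglift1 !scaleN1r.
(* The generators in [y4] and [y5] have the same differential and enter [y] with opposite signs. *)
have dy : dtotal y = 0.
  rewrite /dtotal yE !linearD !linearN /= !dW_bar1 !dmu_bar1 d4' d5'.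
  by rewrite !addNr addr0.
(* Subtracting [x4] and [x5] adds [p + q] under [dW], which cancels [dmu x] modulo the relations;
   their own [dmu] leaves [- y4 + y5]. *)
pose z := x - x4 - x5.
have dz : relations (dtotal z - y).
  suff -> : dtotal z - y = dmu x - (- p - q) by [].
  rewrite /dtotal /z !linearB /= dWx dWx4 dWx5 dmux4 dmux5 yE !opprK add0r.
  by rewrite -[dmu x - y4 + y5]addrA [p + q + _]addrA addrK addrC.
have col_z : columns_le 2 z.
  rewrite /z -!scaleN1r; do !apply: columns_leD; first exact: columns_le_bar3.
    by apply/columns_leZ/(columns_leW (p := 1))/columns_le_bar2.
  by apply/columns_leZ/(columns_leW (p := 1))/columns_le_bar2.
have col_y : columns_le 0 y.
  by rewrite yE -scaleN1r; apply: columns_leD; [apply: columns_leZ |]; apply: columns_le_bar1.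
(* The representative [z] differs from [x] only in columns at most 1, and [dtotal z] is in column 0
   modulo the relations, with [y] as witness. The target [y] represents itself. *)
exists z, y; split.
- split; first split.
  + exact: columns_le_filtration.
  + by exists y.
  have -> : z - x = - x4 - x5 by rewrite /z -[x - x4 - x5]addrA [x + _]addrC addrK.
  rewrite -!scaleN1r; apply: columns_le_filtration.
  by apply: columns_leD; apply/columns_leZ/columns_le_bar2.
- split; first split.
  + exact: columns_le_filtration.
  + by rewrite dy; apply/columns_le_filtration/columns_le0.
  by rewrite -/y (subrr y); apply/columns_le_filtration/columns_le0.
(* Since [dtotal z] and [y] agree modulo the relations, the boundary required is the zero one. *)
have cyc0 r k : cycles (@relations D) (@dtotal D) (@columns_le D) r k 0.
  by split; rewrite /dtotal ?linear0 ?add0r; apply/columns_le_filtration/columns_le0.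
exists 0, 0; split=> //.
by rewrite /dtotal !linear0 !addr0 subr0.
Qed.
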